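(* For every election $(V,A,\succ)$ with $n=|V|\ge 1$ voters, every integer $k\ge 1$ and every $\beta\in[0,1]$, there exists a set $C\subseteq A$ with $|C|\le k$ that is $\big(\beta+(1-\beta)^k\big)$-undominated, i.e. for every $a\in A\setminus C$, $$\big|\{v\in V: a\succ_v C\}\big|\le \big\lfloor (\beta+(1-\beta)^k)\, n\big\rfloor .$$
   Context: An election $(V,A,\succ)$ consists of a finite nonempty set $V$ of $n$ voters, a finite nonempty set $A$ of candidates, and for each voter $v$ a strict linear order $\succ_v$ on $A$; $a\succeq_v b$ means $a=b$ or $a\succ_v b$. For $C\subseteq A$ and $a\in A\setminus C$, $a\succ_v C$ means $a\succ_v c$ for all $c\in C$. For $\alpha\ge 0$, a set $C\subseteq A$ is $\alpha$-undominated if $|\{v\in V: a\succ_v C\}|\le\lfloor \alpha n\rfloor$ for every $a\in A\setminus C$. *)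

(* Defs.v *)
From mathcomp Require Import all_boot all_order all_algebra.
From mathcomp Require Import reals.
Set Implicit Arguments. Unset Strict Implicit. Unset Printing Implicit Defensive.
Import Order.TTheory GRing.Theory Num.Theory.
Local Open Scope ring_scope.

Definition strict_linear_order (A : finType) (r : rel A) : Prop :=
  irreflexive r /\ transitive r /\ (forall a b, a != b -> r a b || r b a).

(* An election: voters V, candidates A (both finite, nonempty), and for each
   voter v a strict linear order  pref v  (pref v a b  means  a >_v b). *)
Definition election (V A : finType) (pref : V -> rel A) : Prop :=
  (0 < #|V|)%N /\ (0 < #|A|)%N /\ forall v, strict_linear_order (pref v).

Definition prefers_to_set (V A : finType) (pref : V -> rel A) (v : V) (a : A)
  (C : {set A}) : bool := [forall c in C, pref v a c].

Definition undominated (R : realType) (V A : finType) (pref : V -> rel A)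
  (alpha : R) (C : {set A}) : Prop :=
  forall a, a \notin C ->
    (#|[set v | prefers_to_set pref v a C]|%:Z <= Num.floor (alpha * #|V|%:R))%R.

(* Main.v *)
(** Call a lottery x on the candidates an ordinal Lindahl equilibrium at level beta
    if every candidate a satisfies x {c | c >=_v a} < beta for at most beta n voters
    v. Averaged over a drawn from x, this bound always holds, so an equilibrium comes
    from a fixed point theorem; here x ranges over lattice points with denominator N,
    and Scarf's parity argument for primitive sets yields an equilibrium up to O(1/N).
    Given x, each voter v has an up-set of candidates of mass at least beta such that
    only the at most beta n voters with x {c | c >=_v a} < beta can prefer a to one of
    its members. Picking k candidates greedily hits the up-sets of all but
    (1 - beta)^k n voters. As the counts are integers, a large N removes the error. *)
Require Import Defs.
From mathcomp Require Import all_boot all_order all_algebra.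
From mathcomp Require Import reals.
From mathcomp Require Import zify ring lra.
Import Order.TTheory GRing.Theory Num.Theory.
Local Open Scope ring_scope.

Set Implicit Arguments.
Unset Strict Implicit.

(** Deleting one of two elements with equal image keeps the image, so counting rules out a second
    collision. Applied to minimisers and to colours. *)
Lemma imset_collision (T U : finType) (f : T -> U) (P : {set T}) :
  #|f @: P|.+1 = #|P| ->
  exists x y, [/\ x \in P, y \in P, x != y, f x = f y
    & {in P :\ x &, injective f} /\ {in P :\ y &, injective f}].
Proof.
move=> cardP.
have imD x y : x \in P -> y \in P -> x != y -> f x = f y ->
    {in P :\ x &, injective f}.
  move=> xP yP xy fxy; apply/imset_injP.
  have -> : f @: (P :\ x) = f @: P.
    apply/eqP; rewrite eqEsubset imsetS ?subsetDl //=.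
    apply/subsetP => _ /imsetP[z zP ->]; have [->|zx] := eqVneq z x.
      by rewrite fxy imset_f // !inE eq_sym xy.
    by rewrite imset_f // !inE zx.
  by have := cardsD1 x P; rewrite xP; lia.
have [/existsP[x /existsP[y /and4P[xP yP xy /eqP fxy]]]|noc] :=
  boolP [exists x, exists y, [&& x \in P, y \in P, x != y & f x == f y]].
  exists x, y; split=> //; split; first exact: imD fxy.
  by apply: imD xP _ _ => //; rewrite eq_sym.
suff : #|f @: P| = #|P| by lia.
apply: card_in_imset => x y xP yP fxy; apply/eqP; apply: contraNT noc => xy.
by apply/existsP; exists x; apply/existsP; exists y; rewrite xP yP xy fxy eqxx.
Qed.

(** * Scarf's lemma on primitive sets *)

Section Scarf.
Variables (I T : finType) (key : I -> T -> nat) (col : T -> I) (sl : I -> T).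
Hypothesis key_inj : forall i, injective (key i).
Hypothesis colK : cancel sl col.
Hypothesis sl_bot : forall i t, (key i (sl i) <= key i t)%N.
Hypothesis sl_top : forall i j x,
  j != i -> x \notin codom sl -> (key i x < key i (sl j))%N.

(** Scarf's primitivity without the size condition: no point lies above the minima of [D] in all
    orders at once. *)
Definition dominant (D : {set T}) :=
  [forall y, exists i, [forall d in D, (key i y <= key i d)%N]].

Lemma dominantP (D : {set T}) :
  reflect (forall y, exists i, forall d, d \in D -> (key i y <= key i d)%N)
          (dominant D).
Proof.
apply: (iffP forallP) => H y; have := H y.
  by case/existsP => i /forall_inP Hi; exists i.
by case=> i Hi; apply/existsP; exists i; apply/forall_inP.
Qed.

Lemma dominantS (D E : {set T}) : D \subset E -> dominant E -> dominant D.
Proof.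
move=> /subsetP sDE /dominantP domE; apply/dominantP => y.
by have [i Hi] := domE y; exists i => d /sDE; apply: Hi.
Qed.

Definition neighbors (E : {set T}) := [set x | (x \notin E) && dominant (x |: E)].

(** * Neighbors of a dominant set one element short of full size *)

Section Door.
Variables (E : {set T}) (mn : I -> T).
Hypothesis domE : dominant E.
Hypothesis cardE : #|E|.+1 = #|I|.
Hypothesis mnE : forall i, mn i \in E.
Hypothesis mn_le : forall i d, d \in E -> (key i (mn i) <= key i d)%N.

(** The region opened by dropping order [j]. If [j] shares its minimiser with another order, the
    [key j]-maximum of this region is a neighbor of [E]. *)
Definition above j := [set y | [forall i, (i != j) ==> (key i (mn i) < key i y)%N]].

Lemma aboveP j y :
  reflect (forall i, i != j -> (key i (mn i) < key i y)%N) (y \in above j).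
Proof.
rewrite inE; apply: (iffP forallP) => H i; last by apply/implyP; apply: H.
by move/implyP: (H i).
Qed.

Lemma mn_eq i d : d \in E -> (forall e, e \in E -> (key i d <= key i e)%N) -> mn i = d.
Proof.
move=> dE dmin; apply: (@key_inj i); apply/eqP.
by rewrite eqn_leq mn_le //= dmin.
Qed.

Lemma mn_onto : mn @: [set: I] = E.
Proof.
apply/eqP; rewrite eqEsubset; apply/andP; split.
  by apply/subsetP => _ /imsetP[i _ ->].
apply/subsetP => d dE; have [i Hi] := dominantP _ domE d.
by rewrite -(@mn_eq i d) // imset_f.
Qed.

Variables (j k : I).
Hypothesis jk : j != k.
Hypothesis mn_jk : mn j = mn k.

Lemma mem_E_mn d : d \in E -> exists2 i, i != j & d = mn i.
Proof.
rewrite -mn_onto => /imsetP[i _ ->]; have [->|ij] := eqVneq i j; last by exists i.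
by exists k; rewrite // eq_sym.
Qed.

(** Order [j] handles the points of [above j]; any other point is at most [mn i] in some order i
    other than [j], where [x] lies higher still. *)
Lemma above_neighbor x :
  x \in above j -> (forall y, y \in above j -> (key j y <= key j x)%N) ->
  x \in neighbors E.
Proof.
move=> xM xmax; rewrite inE; apply/andP; split.
  apply/negP => /mem_E_mn[i ij xE].
  by have := aboveP _ _ xM i ij; rewrite xE ltnn.
apply/dominantP => y; have [yM|] := boolP (y \in above j).
  exists j => d; rewrite !inE => /predU1P[->|dE]; first exact: xmax.
  have [i Hi] := dominantP _ domE y; have [<-|ij] := eqVneq i j; first exact: Hi.
  by have := aboveP _ _ yM i ij; rewrite ltnNge Hi.
rewrite inE => /forallPn[i]; rewrite negb_imply -leqNgt => /andP[ij yi].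
exists i => d; rewrite !inE => /predU1P[->|dE].
  exact: leq_trans yi (ltnW (aboveP _ _ xM i ij)).
by apply: leq_trans yi _; apply: mn_le.
Qed.

Lemma neighbor_above_max x :
  x \in neighbors E -> forall y, y \in above j -> (key j y <= key j x)%N.
Proof.
rewrite inE => /andP[xE /dominantP dom_x] y yM.
have [i Hi] := dom_x y; have [<-|ij] := eqVneq i j; first by apply: Hi; rewrite setU11.
by have := aboveP _ _ yM i ij; rewrite ltnNge Hi // setU1r.
Qed.

Lemma above_disjoint : [disjoint above j & above k].
Proof.
apply/pred0P => y /=; apply/negP => /andP[/aboveP yj /aboveP yk].
have [i Hi] := dominantP _ domE y.
have Hmn := Hi _ (mnE i); have [ij|ij] := eqVneq i j.
  by have := yk i; rewrite ltnNge Hmn ij jk => /(_ isT).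
by have := yj i ij; rewrite ltnNge Hmn.
Qed.

(* Assign to each d in x |: E an index at which it is minimal. The assignment is
   injective, hence onto by cardinality, so away from the index of x the minimum
   of x |: E lies in E. *)
Lemma neighbor_above x : x \in neighbors E -> (x \in above j) || (x \in above k).
Proof.
rewrite inE => /andP[xE dom_x].
have ex d : exists i, [forall e in x |: E, (key i d <= key i e)%N].
  by have /existsP[i Hi] := forallP dom_x d; exists i.
pose w d := xchoose (ex d).
have wP d e : e \in x |: E -> (key (w d) d <= key (w d) e)%N.
  by move=> eE; apply: (forall_inP (xchooseP (ex d))).
have w_inj : {in x |: E &, injective w}.
  move=> d e dE eE wde; apply: (@key_inj (w d)); apply/eqP.
  by rewrite eqn_leq wP //= wde wP.
have w_onto i : exists2 d, d \in x |: E & i = w d.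
  have : w @: (x |: E) = [set: I].
    apply/eqP; rewrite eqEcard subsetT /= card_in_imset // cardsT cardsU1 xE.
    by rewrite -cardE.
  by move=> wT; have := in_setT i; rewrite -wT => /imsetP.
have w_mn i : i != w x -> mn i \in E /\ w (mn i) = i.
  move=> iwx; split; first exact: mnE.
  have [d dE def_i] := w_onto i; move: dE; rewrite !inE => /predU1P[dx|dE].
    by rewrite def_i dx eqxx in iwx.
  by rewrite (@mn_eq i d) // def_i => e eE; apply: wP; rewrite setU1r.
have x_above : x \in above (w x).
  apply/aboveP => i iwx; have [_ wi] := w_mn i iwx.
  have := wP (mn i) x (setU11 _ _); rewrite wi leq_eqVlt => /predU1P[|//].
  by move/key_inj => mx; rewrite -mx mnE in xE.
have [wj|wj] := eqVneq j (w x); first by rewrite wj x_above.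
have [wk|wk] := eqVneq k (w x); first by rewrite wk x_above orbT.
have [_ ej] := w_mn _ wj; have [_ ek] := w_mn _ wk.
by move: jk; rewrite -ej -ek mn_jk eqxx.
Qed.

End Door.

Lemma max_above_card (j : I) (M N : {set T}) :
  (forall x, x \in M -> (forall y, y \in M -> (key j y <= key j x)%N) -> x \in N) ->
  (forall x, x \in N -> forall y, y \in M -> (key j y <= key j x)%N) ->
  #|M :&: N| = (M != set0).
Proof.
move=> maxN Nmax; have [->|[x0 x0M]] := set_0Vmem M; first by rewrite set0I cards0 eqxx.
have -> : M != set0 by apply/set0Pn; exists x0.
have [x xM xmax] : exists2 x, x \in M & forall y, y \in M -> (key j y <= key j x)%N.
  by case: (arg_maxnP (key j) x0M) => x xM xmax; exists x.
have xN : x \in N by apply: maxN => // y yM; apply: xmax.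
rewrite (_ : M :&: N = [set x]) ?cards1 //; apply/setP => y; rewrite !inE.
apply/andP/eqP => [[yM yN]|-> //]; apply: (@key_inj j); apply/eqP.
by rewrite eqn_leq (Nmax x) // (Nmax y).
Qed.

(** The minimisers cover [E] with one index to spare, so some [j] and [k] collide. Each of their two
    disjoint regions, if nonempty, contributes its maximum, and there are no other neighbors. *)
Lemma card_neighbors (E : {set T}) :
  (1 < #|I|)%N -> dominant E -> #|E|.+1 = #|I| ->
  exists mn j k, [/\ forall i, mn i \in E,
    forall i d, d \in E -> (key i (mn i) <= key i d)%N, j != k, mn j = mn k &
    #|neighbors E| = (above mn j != set0) + (above mn k != set0)]%N.
Proof.
move=> I2 domE cardE.
have [e0 e0E] : exists e, e \in E by apply/set0Pn; rewrite -card_gt0; lia.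
pose mn i := [arg min_(d < e0 in E) key i d]%N.
have mnE i : mn i \in E by rewrite /mn; case: arg_minnP.
have mn_le i d : d \in E -> (key i (mn i) <= key i d)%N.
  by rewrite /mn; case: arg_minnP => // x _ H; apply: H.
have [|j [k [_ _ jk mn_jk _]]] := @imset_collision _ _ mn [set: I].
  by rewrite (mn_onto domE mnE mn_le) // cardE cardsT.
have kj : k != j by rewrite eq_sym.
exists mn, j, k; split=> //.
pose N := neighbors E.
have dis : above mn j :&: N :&: (above mn k :&: N) = set0.
  rewrite setIACA (_ : above mn j :&: above mn k = set0) ?set0I //.
  by apply/eqP; rewrite setI_eq0; apply: (above_disjoint domE mnE jk).
have NU : (above mn j :&: N) :|: (above mn k :&: N) = N.
  rewrite -setIUl; apply/setIidPr/subsetP => x xN; rewrite in_setU.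
  exact: (@neighbor_above E mn).
rewrite -{1}/N -{1}NU; have := cardsUI (above mn j :&: N) (above mn k :&: N).
rewrite dis cards0 addn0 => ->.
congr (_ + _)%N.
- apply: (@max_above_card j) => x xM; first exact: (above_neighbor domE mnE mn_le jk mn_jk).
  exact: (neighbor_above_max mnE).
- apply: (@max_above_card k) => x xM; first exact: (above_neighbor domE mnE mn_le kj (esym mn_jk)).
  exact: (neighbor_above_max mnE).
Qed.

(** * Doors, rooms and the parity count *)

Variables (i0 : I) (x0 : T).
Hypothesis x0_sl : x0 \notin codom sl.
Hypothesis I2 : (1 < #|I|)%N.

Definition door (E : {set T}) :=
  [&& dominant E, #|E|.+1 == #|I| & col @: E == [set~ i0]].

Lemma sl_inj : injective sl. Proof. exact: can_inj colK. Qed.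

Lemma door_boundary : door (sl @: [set~ i0]).
Proof.
apply/and3P; split.
- apply/dominantP => y; have [/codomP[i ->]|ysl] := boolP (y \in codom sl).
    by exists i => d _; apply: sl_bot.
  exists i0 => _ /imsetP[i ii0 ->]; apply/ltnW/sl_top => //.
  by move: ii0; rewrite !inE.
- by rewrite card_imset ?cardsC1; [lia | exact: sl_inj].
- by rewrite -imset_comp (eq_imset _ colK) imset_id.
Qed.

(** If [E] contains a non-slack point, then [sl j] and [sl k] lie in the two regions, giving two
    neighbors. Otherwise [E] is the boundary door, with one. *)
Lemma odd_neighbors (E : {set T}) :
  door E -> odd #|neighbors E| = (E == sl @: [set~ i0]).
Proof.
case/and3P => domE /eqP cardE /eqP colE.
have [mn [j [k [mnE mn_le jk mn_jk ->]]]] := card_neighbors I2 domE cardE.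
have [def_E|Enb] := eqVneq E (sl @: [set~ i0]); last first.
  have [e eE esl] : exists2 e, e \in E & e \notin codom sl.
    apply/subsetPn; apply: contraNN Enb => /subsetP Esl.
    rewrite eqEcard card_imset ?cardsC1; last exact: sl_inj.
    rewrite -cardE leqnn andbT; apply/subsetP => e eE.
    have /codomP[i ei] := Esl _ eE; rewrite ei imset_f // -colE -(colK i) -ei.
    by rewrite imset_f.
  have ne l : above mn l != set0.
    apply/set0Pn; exists (sl l); apply/aboveP => i il.
    by apply: leq_ltn_trans (mn_le _ _ eE) _; rewrite sl_top // eq_sym.
  by rewrite !ne.
have slE i : i != i0 -> sl i \in E by move=> ii0; rewrite def_E imset_f // !inE.
have mn_sl i : i != i0 -> mn i = sl i.
  by move=> ii0; apply: (mn_eq mnE mn_le (slE i ii0)) => e _; apply: sl_bot.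
(* Away from [i0] the minimisers are distinct slack vectors, so the collision involves [i0]. *)
wlog def_j : j k jk mn_jk / j = i0.
  move=> W; have [ji|ji] := eqVneq j i0; first exact: W ji.
  have [ki|ki] := eqVneq k i0; last first.
    by move: mn_jk; rewrite !mn_sl // => /sl_inj e; rewrite e eqxx in jk.
  by rewrite addnC; apply: (W k j); rewrite // eq_sym.
subst j; have ki : k != i0 by rewrite eq_sym.
have -> : above mn i0 != set0.
  apply/set0Pn; exists x0; apply/aboveP => i ii0.
  rewrite mn_sl // ltn_neqAle sl_bot andbT; apply: contraNneq x0_sl => /key_inj <-.
  exact: codom_f.
(* A point above [sl k] in order [i0] is some [sl i] with i neither [i0] nor [k], and it would have
   to exceed itself in order i. *)
suff -> : above mn k = set0 by rewrite eqxx.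
apply/setP => y; rewrite in_set0; apply/negP => /aboveP H.
have := H i0; rewrite jk mn_jk mn_sl // => /(_ isT) yi0.
have [/codomP[i yi]|ysl] := boolP (y \in codom sl); last first.
  by have := sl_top ki ysl; lia.
have [ei|ei] := eqVneq i i0.
  by have := sl_bot i0 (sl k); rewrite yi ei in yi0; lia.
have [ek|ek] := eqVneq i k; first by rewrite yi ek ltnn in yi0.
by have := H i ek; rewrite mn_sl // yi ltnn.
Qed.

Definition room (P : {set T}) := dominant P && (#|P| == #|I|).

(** If some removal leaves exactly the colours other than [i0], then one colour occurs twice in [P],
    and its two bearers are the only such removals. *)
Lemma even_doors (P : {set T}) : col @: P != [set: I] ->
  ~~ odd #|[set x | [&& room P, x \in P & col @: (P :\ x) == [set~ i0]]]|.
Proof.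
move=> nfull; set F := [set x | _].
have [->|[x]] := set_0Vmem F; first by rewrite cards0.
rewrite inE => /and3P[rP xP /eqP colx].
have colP : col @: P = [set~ i0].
  apply/eqP; rewrite eqEsubset -{2}colx imsetS ?subsetDl // andbT.
  apply/subsetP => i iP; rewrite !inE; apply: contraNneq nfull => ii0.
  rewrite -subTset; apply/subsetP => l _; have [->|li] := eqVneq l i0; first by rewrite -ii0.
  have: l \in [set~ i0] by rewrite !inE.
  by rewrite -colx; apply: (subsetP (imsetS _ (subsetDl _ _))).
have /andP[_ /eqP cardP] := rP.
have [|u [v [uP vP uv cuv [inju injv]]]] := @imset_collision _ _ col P.
  by rewrite colP cardsC1 cardP; lia.
suff -> : F = [set u; v] by rewrite cards2 uv.
have cardD z : z \in P -> #|P :\ z| = #|I|.-1.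
  by move=> zP; rewrite -cardP (cardsD1 z P) zP.
have colD z : z \in P -> {in P :\ z &, injective col} -> col @: (P :\ z) == [set~ i0].
  move=> zP injz; rewrite eqEcard -colP imsetS ?subsetDl //= colP.
  by rewrite card_in_imset // cardD // cardsC1.
apply/setP => z; rewrite !inE rP /=; apply/idP/idP; last first.
  by case/orP => /eqP ->; rewrite ?uP ?vP colD.
case/andP => zP /eqP colz; apply/norP => -[zu zv].
have /imset_injP injz : #|col @: (P :\ z)| == #|P :\ z|.
  by rewrite colz cardsC1 cardD.
by move: uv; rewrite (injz u v) ?eqxx // !inE 1?eq_sym ?zu ?zv ?uP ?vP // eq_sym.
Qed.

(* Incidences between rooms and doors coloured by I minus i0: a room that is not
   fully coloured has 0 or 2 of these doors, and every such door lies in 2 rooms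
   except the boundary one, which lies in a single room. *)
Lemma scarf : exists P : {set T},
  [/\ dominant P, #|P| = #|I| & col @: P = [set: I]].
Proof.
have [P /andP[/andP[domP /eqP cardP] /eqP colP]|none] :=
  pickP [pred P | room P && (col @: P == [set: I])]; first by exists P.
exfalso.
pose f P x := [&& room P, x \in P & col @: (P :\ x) == [set~ i0]].
have E1 : (\sum_P \sum_(x | f P x) 1 = \sum_(E | door E) #|neighbors E|)%N.
  under [RHS]eq_bigr do rewrite -sum1_card.
  rewrite !pair_big_dep /=.
  rewrite (reindex_onto (fun p : {set T} * T => (p.2 |: p.1, p.2))
                        (fun p => (p.1 :\ p.2, p.2))) /=; last first.
    by case=> P x /= /and3P[_ xP _]; rewrite setD1K.
  apply: eq_bigl => -[E x] /=; rewrite xpair_eqE eqxx andbT /f /door /room setU11 [x \in neighbors E]inE.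
  have [xE|xE] := boolP (x \in E).
    rewrite [RHS]andbF andbC; apply/negP => /andP[/eqP defE _].
    by move: xE; rewrite -defE !inE eqxx.
  rewrite setU1K // eqxx andbT cardsU1 xE add1n /=.
  have [dx|] := boolP (dominant (x |: E)); last by rewrite andbF.
  by rewrite (dominantS _ dx) ?subsetUr // andbT.
have odd_big (J : finType) (Q : pred J) (F : J -> nat) :
    odd (\sum_(i | Q i) F i) = \big[addb/false]_(i | Q i) odd (F i).
  exact: (big_morph odd oddD).
have := congr1 odd E1; rewrite !odd_big big1 => [|P _]; last first.
  have [full|nfull] := eqVneq (col @: P) [set: I].
    rewrite big1 // => x /and3P[rP _ _].
    by have := none P; rewrite /= rP full eqxx.
  apply/negbTE; have := even_doors nfull.
  by rewrite -sum1_card; under eq_bigl do rewrite inE.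
rewrite (bigD1 (sl @: [set~ i0])) ?door_boundary //= odd_neighbors ?door_boundary //.
by rewrite eqxx big1 // => E /andP[dE /negbTE nE]; rewrite odd_neighbors.
Qed.

End Scarf.

(** * Lattice points of the simplex *)

Section Lattice.
Variables (A : finType) (N : nat).

Definition lattice := {x : {ffun A -> 'I_N.+1} | (\sum_a x a == N)%N}.
Definition pt (x : lattice) (a : A) : nat := val x a.

Lemma pt_le x a : (pt x a <= N)%N.
Proof. by rewrite /pt -ltnS ltn_ord. Qed.

Lemma sum_pt x : (\sum_a pt x a = N)%N.
Proof. exact/eqP/(valP x). Qed.

Lemma lattice_of (f : A -> nat) : (\sum_a f a = N)%N -> exists x, pt x =1 f.
Proof.
move=> sumf.
have f_lt a : (f a < N.+1)%N by rewrite ltnS -sumf (bigD1 a) //= leq_addr.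
have xP : (\sum_a [ffun a => Ordinal (f_lt a)] a == N)%N.
  by apply/eqP; rewrite -[RHS]sumf; apply: eq_bigr => a _; rewrite ffunE.
by exists (exist _ [ffun a => Ordinal (f_lt a)] xP) => a; rewrite /pt /= ffunE.
Qed.

(* Coordinate i with ties broken by enumeration; the slack vector i is lowest for
   coordinate i and the others lie above all lattice points. *)
Definition lkey (i : A) (t : lattice + A) : nat :=
  match t with
  | inl x => (pt x i * #|{: lattice}| + enum_rank x).+1
  | inr j => if j == i then 0%N else (N.+1 * #|{: lattice}| + enum_rank j).+1
  end.

Lemma lkey_lt i x : (lkey i (inl x) <= N.+1 * #|{: lattice}|)%N.
Proof.
rewrite /= -addnS mulSn addnC leq_add ?ltn_ord // leq_mul2r.
by rewrite pt_le orbT.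
Qed.

Lemma lkey_inj i : injective (lkey i).
Proof.
have M x y : lkey i (inl x) = lkey i (inl y) -> x = y.
  move=> [/(congr1 (modn^~ #|{: lattice}|))]; rewrite !modnMDl !modn_small //.
  by move=> /ord_inj/enum_rank_inj.
move=> [x|j] [y|l]; first by move=> /M ->.
- have := lkey_lt i x; rewrite /=; case: eqP => // _; lia.
- have := lkey_lt i y; rewrite /=; case: eqP => // _; lia.
- rewrite /=; case: eqP => [->|_]; case: eqP => [->|_] //.
  by move=> [/addnI/ord_inj/enum_rank_inj ->].
Qed.

Lemma lkey_pt i x y : (lkey i (inl x) <= lkey i (inl y))%N -> (pt x i <= pt y i)%N.
Proof.
rewrite /= ltnS; have := ltn_ord (enum_rank y).
set K := #|_|; set r := nat_of_ord _; set q := nat_of_ord _.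
move=> rK le; rewrite leqNgt; apply/negP => lt.
have : ((pt y i).+1 * K <= pt x i * K)%N by rewrite leq_mul2r lt orbT.
by rewrite mulSn; move: le rK; clearbody K r q; lia.
Qed.

Section Coloured.
Variables (c : lattice -> A) (a0 : A).
Hypothesis A2 : (1 < #|A|)%N.

(* The full Scarf set, with the slack vectors removed: D is dominant for the
   coordinates in S, so it lies near the face spanned by S and has diameter O(1). *)
Lemma scarf_lattice : exists (S : {set A}) (D : {set lattice}),
  [/\ forall x, x \in D -> c x \in S,
      forall a, a \in S -> exists2 x, x \in D & c x = a &
      forall y, exists2 i, i \in S & forall d, d \in D -> (pt y i <= pt d i)%N].
Proof.
pose col (t : lattice + A) := match t with inl x => c x | inr j => j end.
have [x0 _] : exists x0, pt x0 =1 (fun a => if a == a0 then N else 0%N).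
  by apply: lattice_of; rewrite -big_mkcond big_pred1_eq.
have [||||||P [domP cardP colP]] := @scarf A (lattice + A)%type lkey col inr _ _ _ _ a0 (inl x0).
- exact: lkey_inj.
- by [].
- by move=> i t; rewrite /= eqxx.
- move=> i j [x|l] ji; last by rewrite codom_f.
  by move=> _; apply: leq_ltn_trans (lkey_lt i x) _; rewrite /= (negbTE ji) ltnS leq_addr.
- by apply/codomP => -[].
- by [].
have /imset_injP col_inj : #|col @: P| == #|P| by rewrite colP cardP cardsT.
exists [set a | inr a \notin P], [set x | inl x \in P]; split.
- move=> x; rewrite !inE => xP; apply/negP => cP.
  by have := col_inj _ _ xP cP erefl.
- move=> a; rewrite inE => aP; have := in_setT a; rewrite -colP.
  case/imsetP => -[x|j] tP def_a; first by exists x; rewrite ?inE.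
  by rewrite def_a tP in aP.
- move=> y; have [i Hi] := dominantP _ _ domP (inl y); exists i.
    by rewrite inE; apply/negP => /Hi; rewrite /= eqxx.
  by move=> d; rewrite inE => /Hi; apply: lkey_pt.
Qed.

(** Dominance makes the coordinatewise minima [mu] of [D] sum to nearly [N] over [S]. Points of [D]
    exceed [mu] by less than [#|A|] in total, so they are close to each other. *)
Lemma near_fixed_point : exists (S : {set A}) (x : lattice),
  (N <= \sum_(a in S) pt x a + #|A|)%N /\
  forall a, a \in S -> exists2 y, c y = a & forall U : {set A},
    (\sum_(b in U) pt x b <= \sum_(b in U) pt y b + #|A|)%N /\
    (\sum_(b in U) pt y b <= \sum_(b in U) pt x b + #|A|)%N.
Proof.
have [S [D [colS colD domD]]] := scarf_lattice.
have [d0 d0D] : exists d, d \in D.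
  have [y _] : exists y, pt y =1 (fun a => if a == a0 then N else 0%N).
    by apply: lattice_of; rewrite -big_mkcond big_pred1_eq.
  by have [i /colD[d dD _] _] := domD y; exists d.
pose mu i := pt [arg min_(d < d0 in D) pt d i]%N i.
have mu_le d i : d \in D -> (mu i <= pt d i)%N.
  by rewrite /mu; case: arg_minnP => // x _ H; apply: H.
have mu_eq i : exists2 d, d \in D & mu i = pt d i.
  by rewrite /mu; case: arg_minnP => // x xD _; exists x.
have sum_mu : (N < \sum_(i in S) mu i + #|A|)%N.
  rewrite ltnNge; apply/negP => small.
  have le : (\sum_(i in S) (mu i).+1 <= N)%N.
    under eq_bigr do rewrite -addn1.
    rewrite big_split /= sum1_card; apply: leq_trans small.
    by rewrite leq_add2l max_card.
  have s0S := colS _ d0D; set s0 := c d0 in s0S.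
  (* Raising each minimum on [S] by one and putting the leftover mass on [s0] gives a point that
     contradicts [domD]. *)
  pose f i := ((if i \in S then (mu i).+1 else 0) +
    (if i == s0 then N - \sum_(i in S) (mu i).+1 else 0))%N.
  have [|y yf] := @lattice_of f.
    by rewrite big_split /= -!big_mkcond big_pred1_eq /= subnKC.
  have [i iS Hi] := domD y; have [d dD mui] := mu_eq i.
  by have := Hi _ dD; rewrite yf /f iS -mui; lia.
have near x y (U : {set A}) : x \in D -> y \in D ->
    (\sum_(b in U) pt x b <= \sum_(b in U) pt y b + #|A|)%N.
  move=> xD yD.
  (* Coordinatewise, [mu] is paid for by [y] inside [U] and by [x] outside it. *)
  have: (\sum_(b in U) pt x b + \sum_(b in S) mu b <=
         \sum_(b in U) pt y b + \sum_b pt x b)%N.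
    rewrite [(\sum_(b in U) pt x b)%N]big_mkcond [(\sum_(b in U) pt y b)%N]big_mkcond.
    rewrite [(\sum_(b in S) mu b)%N]big_mkcond -!big_split /=; apply: leq_sum => b _.
    have := mu_le x b xD; have := mu_le y b yD.
    by case: (b \in U); case: (b \in S); lia.
  rewrite sum_pt; lia.
exists S, d0; split.
  apply: leq_trans (ltnW sum_mu) _; rewrite leq_add2r.
  by apply: leq_sum => i _; apply: mu_le.
by move=> a /colD[y yD <-]; exists y => // U; split; apply: near.
Qed.

End Coloured.
End Lattice.

(** * Approximate Lindahl equilibria and greedy selection *)

Section Election.
Variables (V A : finType) (pref : V -> rel A).
Hypothesis lin : forall v, strict_linear_order (pref v).

Definition upset v a := [set c | (c == a) || pref v c a].

Lemma upset_refl v a : a \in upset v a.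
Proof. by rewrite inE eqxx. Qed.

Lemma upset_sub v a b : b \in upset v a -> upset v b \subset upset v a.
Proof.
have [_ [tr _]] := lin v; rewrite inE => /predU1P[-> //|ba]; apply/subsetP => c.
rewrite !inE => /predU1P[->|cb]; first by rewrite ba orbT.
by rewrite (tr b) // orbT.
Qed.

Lemma upset_total v a b : b \notin upset v a -> a \in upset v b.
Proof.
have [_ [_ tot]] := lin v; rewrite !inE negb_or => /andP[ba /negbTE nba].
by have := tot _ _ ba; rewrite nba /= => ->; rewrite orbT.
Qed.

Lemma upset_pref v a b : pref v a b -> b \notin upset v a.
Proof.
have [irr [tr _]] := lin v => ab; rewrite inE; apply/norP; split.
  by apply: contraTneq ab => ->; rewrite irr.
by apply/negP => ba; have := tr _ _ _ ab ba; rewrite irr.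
Qed.

Lemma upset_card v a b : b \notin upset v a -> (#|upset v a| < #|upset v b|)%N.
Proof.
move=> nba; apply: proper_card; apply/properP; split.
  exact/upset_sub/upset_total.
by exists b => //; apply: upset_refl.
Qed.

Lemma worst_exists v (B : {set A}) b :
  b \in B -> exists2 a, a \in B & B \subset upset v a.
Proof.
move=> bB; case: (arg_maxnP (fun a => #|upset v a|) bB) => a aB amax.
exists a => //; apply/subsetP => c cB; apply: contraT => /upset_card.
by rewrite ltnNge => /negP[]; apply: amax.
Qed.

Lemma best_exists v (B : {set A}) b :
  b \in B -> exists2 a, a \in B & forall c, c \in B -> a \in upset v c.
Proof.
move=> bB; case: (arg_minnP (fun a => #|upset v a|) bB) => a aB amin.
exists a => // c cB; apply: contraT => /upset_card.
by rewrite ltnNge amin.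
Qed.

(** * Low candidates and greedy covering for fixed weights *)

Section Weights.
Variable w : A -> nat.

(** With [s] in the role of beta N, this is the condition x {c | c >=_v a} < beta. *)
Definition low s v a := (\sum_(b in upset v a) w b < s)%N.

(** The worst low candidate has an up-set of mass below [s], and it contains every low candidate. *)
Lemma sum_low s v : (\sum_(a | low s v a) w a <= s)%N.
Proof.
have [B0|[b bB]] := set_0Vmem [set a | low s v a].
  by rewrite big_pred0 // => a; have /setP/(_ a) := B0; rewrite !inE.
have [a aB Ba] := worst_exists v bB; move: aB; rewrite inE => /ltnW; apply: leq_trans.
rewrite [leqRHS](bigID (low s v)) /= -[leqLHS]addn0 leq_add //.
rewrite leq_eqVlt; apply/orP; left; apply/eqP; apply: eq_bigl => c.
case lc: (low s v c); rewrite ?andbF // andbT.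
by have /subsetP/(_ c) := Ba; rewrite inE lc => ->.
Qed.

Definition rejecting s a := [set v | low s v a].

Lemma sum_rejecting s : (\sum_a w a * #|rejecting s a| <= s * #|V|)%N.
Proof.
have -> : (\sum_a w a * #|rejecting s a| = \sum_v \sum_(a | low s v a) w a)%N.
  rewrite (exchange_big_dep xpredT) //=; apply: eq_bigr => a _.
  rewrite -sum1_card big_distrr /=; apply: eq_big => [v|v _]; first by rewrite inE.
  exact: muln1.
by rewrite mulnC -sum_nat_const; apply: leq_sum => v _; apply: sum_low.
Qed.

Definition good s v := [set c | [forall a, pref v a c ==> low s v a]].

(** Let e be the best candidate outside [good s v], and a a non-low candidate preferred to e. The
    up-set of a has mass at least [s] and is good, since all bad candidates are e or worse. *)
Lemma good_mass s v : (s <= \sum_a w a)%N -> (s <= \sum_(a in good s v) w a)%N.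
Proof.
move=> sw; have [B0|[b bB]] := set_0Vmem (~: good s v).
  by rewrite -(setCK (good s v)) B0 setC0; under [leqRHS]eq_bigl do rewrite in_setT.
have [e] := best_exists v bB.
rewrite !inE => /forallPn[a]; rewrite negb_imply /low -leqNgt => /andP[ae sa] ebest.
apply: leq_trans sa _; rewrite [leqRHS](bigID (mem (upset v a))) /= -[leqLHS]addn0.
rewrite leq_add // leq_eqVlt; apply/orP; left; apply/eqP; apply: eq_bigl => c.
case ca: (c \in upset v a); rewrite ?andbF // andbT; apply/esym; apply: contraT => cB.
have /subsetP/(_ e) := upset_sub ca; rewrite ebest ?(negbTE (upset_pref ae)); last by rewrite in_setC.
by move/(_ isT).
Qed.

Definition uncovered s (C : {set A}) := [set v | [disjoint C & good s v]].

Lemma card_prefers s a C :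
  (#|[set v | prefers_to_set pref v a C]| <= #|rejecting s a| + #|uncovered s C|)%N.
Proof.
apply: leq_trans (leq_card_setU _ _); apply: subset_leq_card; apply/subsetP => v.
rewrite !inE => /forall_inP aC; have [//|nlow] := boolP (low s v a).
rewrite -setI_eq0; apply/eqP/setP => c; rewrite !inE; apply/negP.
case/andP => cC /forallP/(_ a); rewrite aC //=; exact/negP.
Qed.

(** For c drawn with weights [w], [good_mass] bounds by 1 - s / N the chance that a given voter
    stays uncovered. Some c does no worse than the average. *)
Lemma greedy_step s C : (0 < \sum_a w a)%N -> (s <= \sum_a w a)%N ->
  exists c, (#|uncovered s (c |: C)| * \sum_a w a <=
             #|uncovered s C| * (\sum_a w a - s))%N.
Proof.
move=> w0 sw; set N := (\sum_a w a)%N in w0 sw *; set u := #|uncovered s C|.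
have [/existsP[c]|no] := boolP [exists c, #|uncovered s (c |: C)| * N <= u * (N - s)]%N.
  by exists c.
have lt c : (u * (N - s) < #|uncovered s (c |: C)| * N)%N.
  by rewrite ltnNge; move/existsPn: no; apply.
have avg : (\sum_c w c * #|uncovered s (c |: C)| <= u * (N - s))%N.
  have -> : (\sum_c w c * #|uncovered s (c |: C)| =
             \sum_(v in uncovered s C) \sum_(c | c \notin good s v) w c)%N.
    rewrite (exchange_big_dep xpredT) //=; apply: eq_bigr => c _.
    rewrite -sum1_card big_distrr /=; apply: eq_big => [v|v _]; last exact: muln1.
    by rewrite !inE -!setI_eq0 setIUl setU_eq0 !setI_eq0 disjoints1 andbC !inE.
  rewrite -sum_nat_const; apply: leq_sum => v _.
  have defN : (N = \sum_(c in good s v) w c + \sum_(c | c \notin good s v) w c)%N.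
    by rewrite /N (bigID (mem (good s v))).
  by rewrite leq_subRL // defN leq_add2r good_mass.
have : (\sum_c w c * (u * (N - s)).+1 <= \sum_c w c * (#|uncovered s (c |: C)| * N))%N.
  by apply: leq_sum => c _; rewrite leq_mul2l lt orbT.
rewrite -big_distrl /= -/N; under [X in (_ <= X)%N]eq_bigr do rewrite mulnA.
rewrite -big_distrl /= mulnC leq_mul2r; lia.
Qed.

Lemma greedy s k : (0 < \sum_a w a)%N -> (s <= \sum_a w a)%N ->
  exists2 C : {set A}, (#|C| <= k)%N &
    (#|uncovered s C| * (\sum_a w a) ^ k <= #|V| * (\sum_a w a - s) ^ k)%N.
Proof.
move=> w0 sw; elim: k => [|k [C cardC uC]].
  by exists set0; rewrite ?cards0 // !expn0 !muln1 max_card.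
have [c uc] := greedy_step C w0 sw; exists (c |: C).
  by rewrite cardsU1; apply: leq_trans (_ : 1 + k <= _)%N; rewrite ?leq_add ?leq_b1.
rewrite !expnS mulnA; apply: leq_trans (leq_mul uc (leqnn _)) _.
by rewrite mulnAC [leqRHS]mulnCA [leqRHS]mulnC leq_mul.
Qed.

End Weights.

(* An approximate ordinal Lindahl equilibrium: colour each lattice point by a
   candidate rejected by the most voters. Near a fully coloured set all candidates
   of (almost) full mass are maximally rejected, while sum_rejecting bounds the
   average rejection. *)
Lemma lindahl (N s : nat) : (1 < #|A|)%N -> exists x : lattice A N,
  forall b, (#|rejecting (pt x) s b| * (N - #|A|) <= (s + 2 * #|A|) * #|V|)%N.
Proof.
move=> A2; have /card_gt0P[a0 _] : (0 < #|A|)%N by lia.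
set m := #|A|.
(* The level [s + m] is halfway: moving from [x] to a nearby point costs [m], and returning costs
   [m] again. *)
pose c (x : lattice A N) := [arg max_(a > a0) #|rejecting (pt x) (s + m) a|]%N.
have cmax x b : (#|rejecting (pt x) (s + m) b| <= #|rejecting (pt x) (s + m) (c x)|)%N.
  by rewrite /c; case: arg_maxnP => // i _ H; apply: H.
have [S [x [xS near]]] := near_fixed_point c a0 A2; exists x => b.
have rejS (y z : lattice A N) r a : (forall U : {set A},
    \sum_(b in U) pt z b <= \sum_(b in U) pt y b + m)%N ->
    (#|rejecting (pt y) r a| <= #|rejecting (pt z) (r + m) a|)%N.
  move=> yz; apply: subset_leq_card; apply/subsetP => v; rewrite !inE /low => lt.
  by apply: leq_ltn_trans (yz _) _; rewrite ltn_add2r.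
have gS a : a \in S -> (#|rejecting (pt x) s b| <= #|rejecting (pt x) (s + 2 * m) a|)%N.
  case/near => y <- xy; apply: leq_trans (rejS x y s b _) _; first by move=> U; case: (xy U).
  apply: leq_trans (cmax y b) _; rewrite mul2n -addnn addnA.
  by apply: rejS => U; case: (xy U).
apply: leq_trans (sum_rejecting (pt x) (s + 2 * m)).
(* [S] carries at least [N - m] of the mass of [x]. *)
apply: leq_trans (_ : \sum_(a in S) pt x a * #|rejecting (pt x) s b| <= _)%N.
  by rewrite -big_distrl /= mulnC leq_mul2r; lia.
rewrite [leqRHS](bigID (mem S)) /= -[leqLHS]addn0 leq_add //.
by apply: leq_sum => a aS; rewrite leq_mul2l gS ?orbT.
Qed.

End Election.

(** * Choice of the lattice size and rounding *)

Lemma exprD_le_linear (R : realDomainType) (y : R) (k : nat) : 0 <= y -> y <= 1 ->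
  exists2 K : R, 0 <= K &
    forall h : R, 0 <= h -> h <= 1 -> (y + h) ^+ k <= y ^+ k + K * h.
Proof.
move=> y0 y1; elim: k => [|k [K K0 IH]].
  by exists 0 => // h _ _; rewrite !expr0 mul0r addr0.
(* Besides y^(k+1), the product of y + h and y^k + K h has terms bounded by h, K h and K h. *)
exists (2 * K + 1) => [|h h0 h1]; first lra.
rewrite !exprS.
have := ler_wpM2l (addr_ge0 y0 h0) (IH h h0 h1); move/le_trans; apply.
have yk1 : y ^+ k <= 1 by rewrite exprn_ile1.
have yk0 : 0 <= y ^+ k by rewrite exprn_ge0.
have : h * y ^+ k <= h by rewrite ler_piMr.
have Kh0 : 0 <= K * h by rewrite mulr_ge0.
have : y * (K * h) <= K * h by rewrite ler_piMl.
have : h * (K * h) <= K * h by rewrite ler_piMl.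
by lra.
Qed.

Unset Implicit Arguments.

Theorem theorem1 (R : realType) (V A : finType) (pref : V -> rel A)
  (k : nat) (beta : R) :
  election pref -> (1 <= k)%N -> 0 <= beta -> beta <= 1 ->
  exists C : {set A}, (#|C| <= k)%N /\
    undominated pref (beta + (1 - beta) ^+ k) C.
Proof.
move=> [_ [_ lin]] k1 b0 b1.
have [Ak|kA] := leqP #|A| k.
  by exists [set: A]; rewrite cardsT; split=> // a; rewrite in_setT.
have A2 : (1 < #|A|)%N by lia.
set n : R := #|V|%:R; set m : R := #|A|%:R; set alpha := beta + _.
have n0 : 0 <= n by rewrite ler0n.
have m0 : 0 <= m by rewrite ler0n.
have [||K K0 HK] := @exprD_le_linear R (1 - beta) k; [lra | lra |].
(* The count is an integer, so staying below [F + 1] suffices; [delta] is the positive slack this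
   leaves. *)
set F := Num.floor (alpha * n).
have delta0 : 0 < (F + 1)%:~R - alpha * n by rewrite subr_gt0 floorD1_gt.
set delta := _ - alpha * n in delta0.
have B0 : 0 <= n * (3 * m + K) / delta.
  by rewrite divr_ge0 ?(ltW delta0) // mulr_ge0 // addr_ge0 // mulr_ge0.
(* The total error will be n (3 m + K) / M, below [delta] for this [M]. Adding [#|A|] in [N] turns
   the factor [N - #|A|] of [lindahl] into [M]. *)
pose M := (Num.bound (n * (3 * m + K) / delta)).+1.
have Mbig : n * (3 * m + K) < delta * M%:R.
  rewrite [ltRHS]mulrC -ltr_pdivrMr //; apply: lt_trans (archi_boundP B0) _.
  by rewrite ltr_nat.
pose N := (#|A| + M)%N; pose s := Num.truncn (beta * N%:R).
have /andP[s_le s_gt] : s%:R <= beta * N%:R < s.+1%:R.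
  by apply: truncn_itv; rewrite mulr_ge0.
have sN : (s <= N)%N.
  by rewrite -(ler_nat R); apply: le_trans s_le _; rewrite ler_piMl.
have [x Hx] := @lindahl V A pref lin N s A2.
have N_gt0 : (0 < N)%N by rewrite /N /M addnS.
have [||C Ck HC] := @greedy V A pref lin (pt x) s k; rewrite ?sum_pt //.
exists C; split=> // a aC; rewrite -ltzD1 -(ltr_int R).
have := card_prefers pref (pt x) s a C; set t := #|_| => tgu.
rewrite -/n -/alpha -/F -pmulrn.
have := Hx a; set g := #|rejecting _ _ _ _| in tgu * => Hg.
move: HC; rewrite sum_pt; set u := #|uncovered _ _ _ _| in tgu * => Hu.
have M0 : 0 < M%:R :> R by rewrite ltr0n.
have N0 : 0 < N%:R :> R by rewrite ltr0n.
have NE : N%:R = m + M%:R :> R by rewrite natrD.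
set h : R := M%:R^-1.
have h0 : 0 <= h by rewrite invr_ge0 ltW.
have h1 : h <= 1 by rewrite invf_le1 // ler1n.
(* Of the 3 m, two come from [lindahl] and one from replacing beta N by beta M. *)
have g_le : g%:R <= n * beta + n * (3 * m) * h.
  move: Hg; rewrite /N addKn -(ler_nat R) !natrM natrD natrM -/m -/n => Hg.
  have : g%:R * M%:R <= (beta * M%:R + 3 * m) * n.
    apply: le_trans Hg _; apply: ler_wpM2r => //.
    have : beta * m <= m by rewrite ler_piMl.
    by rewrite NE mulrDr in s_le; lra.
  rewrite -ler_pdivlMr // => /le_trans; apply; rewrite le_eqVlt; apply/orP; left.
  by apply/eqP; rewrite /h; field; rewrite gt_eqF.
(* Rounding gives s > beta N - 1, so (N - s) / N is at most 1 - beta + 1 / N, hence at most 1 - beta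
   + h. *)
have u_le : u%:R <= n * ((1 - beta) ^+ k + K * h).
  move: Hu; rewrite -(ler_nat R) !natrM !natrX natrB // -/n => Hu.
  have : u%:R <= n * ((N%:R - s%:R) / N%:R) ^+ k.
    by rewrite expr_div_n mulrA ler_pdivlMr // exprn_gt0.
  move/le_trans; apply; apply: ler_wpM2l => //; apply: le_trans (HK h h0 h1).
  apply: lerXn2r; rewrite ?nnegrE.
  - by rewrite divr_ge0 // ?subr_ge0 ?ler_nat // ltW.
  - by lra.
  - have hN : N%:R^-1 <= h by rewrite /h lef_pV2 ?posrE // NE; lra.
    apply: le_trans (_ : 1 - beta + N%:R^-1 <= _); last lra.
    rewrite ler_pdivrMr // !mulrDl mulVf ?gt_eqF // mul1r mulNr.
    by move: s_gt; rewrite -natr1; lra.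
have tgu' : t%:R <= g%:R + u%:R :> R by rewrite -natrD ler_nat.
have Mbig' : n * (3 * m + K) * h < delta by rewrite /h ltr_pdivrMr.
have : (F + 1)%:~R = alpha * n + delta by rewrite /delta; ring.
move=> ->; rewrite /alpha; move: Mbig' g_le u_le tgu'; lra.
Qed.
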